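(* Let $\Gamma = (I,(A_i)_{i\in I},(u_i)_{i\in I})$ be a game in normal form, and let $\mathcal{E}^n$ and $\mathcal{E}^u$ be the classes of all nested and of all universal elimination sequences of $\Gamma$, respectively. If all reductions of $\Gamma$ are completely bounded, then $\mathcal{E}^n = \mathcal{E}^u$.
   Context: Game. $I$ is a set of players with at least two elements (otherwise of arbitrary cardinality); each $A_i$ is a non-empty set (of arbitrary cardinality) of pure strategies; $A=\prod_{j\in I}A_j$; $u_i:A\to\mathbb{R}$ is player $i$'s payoff function. No topological or measurability assumptions are made. Reductions. A reduction is a subset $R\subseteq A$ of the form $R=\prod_{i\in I}R_i$ with $R_i\subseteq A_i$ (possibly empty). Write $R_{-i}=\prod_{j\neq i}R_j$. Reductions are compared as subsets of $A$. For non-empty $R$ the factors $R_i$ are uniquely determined; all products with an empty factor are the same reduction $\emptyset$, and a relation $R\to\emptyset$ below is understood to hold if it holds for some choice of factors representing $\emptyset$. Strict dominance. For non-empty $R_{-i}$ and $a_i,b_i\in A_i$, write $a_i\prec_{R_{-i}}b_i$ ($a_i$ is strictly dominated by $b_i$ relative to $R_{-i}$) if $u_i(a_i,a_{-i})<u_i(b_i,a_{-i})$ for all $a_{-i}\in R_{-i}$. Dominance is defined only relative to non-empty $R_{-i}$; hence conditions about dominance impose nothing when $R=\emptyset$. For reductions $R,S$: - $R\xrightarrow{n}S$ ($S$ is a nested reduction of $R$) if $S\subseteq R$ and for all $i\in I$: if $a_i\in R_i\setminus S_i$, then there is $b_i\in R_i$ with $a_i\prec_{R_{-i}}b_i$.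 - $R\xrightarrow{u}S$ ($S$ is a universal reduction of $R$) if $S\subseteq R$ and for all $i\in I$: if $a_i\in R_i\setminus S_i$, then there is $b_i\in A_i$ with $a_i\prec_{R_{-i}}b_i$. Elimination sequences. For $\ell\in\{n,u\}$, an elimination sequence of type $\ell$ (nested if $\ell=n$, universal if $\ell=u$) is an ordinal-indexed sequence of reductions $\langle R^\alpha:\alpha<\delta\rangle$, with $\delta$ any non-zero ordinal, such that: $R^0=A$; $R^\alpha\xrightarrow{\ell}R^{\alpha+1}$ whenever $\alpha+1<\delta$; $R^\lambda=\bigcap_{\alpha<\lambda}R^\alpha$ for all limit ordinals $\lambda<\delta$; and there is a reduction $\hat R$ such that $R^\alpha=\hat R$ for some $\alpha<\delta$ and, for every reduction $S$, $\hat R\xrightarrow{\ell}S$ only if $S=\hat R$. Complete boundedness. A reduction $R$ is completely bounded if for all $i\in I$ and all $a_i\in R_i$: if $a_i\prec_{R_{-i}}b_i$ for some $b_i\in A_i$, then there is $c_i^*\in A_i$ such that $a_i\prec_{R_{-i}}c_i^*$ and there is no $c_i\in A_i$ with $c_i^*\prec_{R_{-i}}c_i$. *)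

(* Defs.v *)
From mathcomp Require Import all_boot all_order all_algebra.
From mathcomp Require Import boolp classical_sets reals.
From mathcomp Require wochoice.

Set Implicit Arguments.
Unset Strict Implicit.
Unset Printing Implicit Defensive.

Import Order.TTheory GRing.Theory Num.Theory.
Local Open Scope classical_set_scope.
Local Open Scope ring_scope.

Record game (R : realType) := Game {
  player : Type;
  strategy : player -> Type;
  payoff : player -> (forall j, strategy j) -> R;
  two_players : exists i j : player, i <> j;
  strategy_inhabited : forall i, inhabited (strategy i) }.

Section Games.
Variables (R : realType) (G : game R).

Definition profile := forall j : player G, strategy j.

Definition opponents (i : player G) := {j : player G | j <> i}.

Definition opponent_profile (i : player G) :=
  forall j : opponents i, strategy (sval j).

(* The profile (a_i, a_{-i}). *)
Definition join_profile (i : player G) (a : strategy i)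
    (x : opponent_profile i) : profile :=
  fun j => match pselect (j = i) with
           | left e => eq_rect_r (@strategy R G) a e
           | right ne => x (exist _ j ne)
           end.

Definition box (F : forall i : player G, set (strategy i)) : set profile :=
  [set x | forall i, F i (x i)].

Definition opponent_box (F : forall i : player G, set (strategy i))
    (i : player G) : set (opponent_profile i) :=
  [set x | forall j : opponents i, F (sval j) (x j)].

Arguments opponent_box F i : clear implicits.

Definition reduction (S : set profile) : Prop := exists F, S = box F.

(* Dominance is defined only relative to a non-empty set of opponents'
   profiles; relative to the empty set nothing is dominated. *)
Definition dominated (i : player G) (X : set (opponent_profile i))
    (a b : strategy i) : Prop :=
  X !=set0 /\
  forall x, X x ->
    payoff i (join_profile a x) < payoff i (join_profile b x).

Inductive elimination_type := nested | universal.

Definition dominators (l : elimination_type)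
    (F : forall i : player G, set (strategy i)) (i : player G) :
    set (strategy i) :=
  match l with nested => F i | universal => setT end.
Arguments dominators l F i : clear implicits.

(* The factors of a non-empty reduction are unique.  Those of the empty one are
   not, hence the existential quantification: in particular S -> set0 holds as
   soon as it holds for one choice of factors representing set0. *)
Definition reduces (l : elimination_type) (S T : set profile) : Prop :=
  T `<=` S /\
  exists F H, [/\ S = box F, T = box H &
    forall (i : player G) (a : strategy i), F i a -> ~ H i a ->
      exists2 b, dominators l F i b & dominated (opponent_box F i) a b].

(* For S = set0 this is vacuous whatever the factors F: if F i a holds then
   opponent_box F i is empty. *)
Definition completely_bounded (S : set profile) : Prop :=
  forall F, S = box F ->
  forall (i : player G) (a : strategy i), F i a ->
    (exists b, dominated (opponent_box F i) a b) ->
    exists2 c, dominated (opponent_box F i) a c &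
      ~ exists d, dominated (opponent_box F i) c d.

End Games.

Arguments reduction {R G} S.
Arguments reduces {R G} l S T.
Arguments completely_bounded {R G} S.

(* A sequence of length a non-zero ordinal delta, indexed by a well-ordered set
   of order type delta (every non-zero ordinal arises in this way). *)
Record ordinal_sequence (T : Type) := OrdinalSequence {
  index : Type;
  index_le : rel index;
  index_well_order : wochoice.well_order index_le;
  index_inhabited : inhabited index;
  term : index -> T }.

Section OrdinalSequences.
Variables (T : Type) (s : ordinal_sequence T).

Definition index_lt (a b : index s) : Prop := index_le a b /\ a <> b.

Definition is_zero (a : index s) : Prop := forall b, index_le a b.

Definition is_succ (a b : index s) : Prop :=
  index_lt a b /\ forall c, index_lt a c -> index_le b c.

Definition is_limit (a : index s) : Prop :=
  ~ is_zero a /\ ~ exists b, is_succ b a.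

End OrdinalSequences.

Definition elimination_sequences (R : realType) (G : game R)
    (l : elimination_type) : set (ordinal_sequence (set (profile G))) :=
  [set s |
    [/\ forall a : index s, reduction (term a),
        forall a : index s, is_zero a -> term a = setT,
        forall a b : index s, is_succ a b -> reduces l (term a) (term b),
        forall a : index s, is_limit a ->
          term a = \bigcap_(b in [set b | index_lt b a]) term b &
        exists Rhat : set (profile G),
          [/\ reduction Rhat, exists a : index s, term a = Rhat &
              forall S, reduction S -> reduces l Rhat S -> S = Rhat]]].

Arguments elimination_sequences {R} G l.

(* Main.v *)
(** Along an elimination sequence of either type, a strategy dominated relative
    to a non-empty term [R] is dominated by a strategy surviving in [R]: complete
    boundedness provides a dominator [c] that is itself undominated relative to
    [R], and [c] cannot have been eliminated before [R], since dominance relative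
    to a larger reduction persists when that reduction shrinks.  Hence
    both types of reduction agree on all terms of the sequence. *)

Require Import Defs.
From mathcomp Require Import all_boot all_order all_algebra.
From mathcomp Require Import boolp classical_sets reals.
From mathcomp Require wochoice.

Set Implicit Arguments.
Unset Strict Implicit.
Unset Printing Implicit Defensive.

Local Open Scope classical_set_scope.

(** [wochoice.well_order] speaks of Boolean predicates; classical reflection carries its least
    elements over to [Prop]-valued sets. *)
Lemma well_order_least (T : Type) (le : rel T) (P : set T) :
  wochoice.well_order le -> P !=set0 ->
  exists2 m, P m & forall x, P x -> le m x.
Proof.
move=> wo [x Px].
have [|m [[mP mle] _]] := wo (fun y => `[< P y >]).
  by exists x; apply/asboolP.
exists m; first exact/asboolP.
by move=> y Py; apply: mle; apply/asboolP.
Qed.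

Section IndexOrder.
Variables (T : Type) (s : ordinal_sequence T).
Implicit Types a b c : Defs.index s.

Lemma index_le_total a b : index_le a b \/ index_le b a.
Proof.
have tot := @wochoice.wo_chainW {classic (Defs.index s)} _ predT
  (wochoice.withinW (@index_well_order _ s)).
by apply/orP; apply: tot.
Qed.

Lemma index_le_anti a b : index_le a b -> index_le b a -> a = b.
Proof.
have anti := @wochoice.wo_chain_antisymmetric {classic (Defs.index s)} _ predT
  (wochoice.withinW (@index_well_order _ s)).
by move=> ab ba; apply: anti => //; apply/andP.
Qed.

Lemma not_index_le a b : ~ index_le a b -> index_lt b a.
Proof.
move=> nab; case: (index_le_total a b) => // ba; split => // eq_ba.
by apply: nab; rewrite eq_ba in ba *.
Qed.

Lemma index_ind (P : Defs.index s -> Prop) :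
  (forall a, (forall b, index_lt b a -> P b) -> P a) -> forall a, P a.
Proof.
move=> step a; apply: contrapT => nPa.
have [|m nPm mle] := @well_order_least _ _ [set b | ~ P b] (@index_well_order _ s).
  by exists a.
apply: (nPm); apply: step => b [bm ne]; apply: contrapT => nPb.
by apply: ne; apply: index_le_anti => //; apply: mle.
Qed.

Variant index_kind a : Prop :=
  | ZeroIndex of is_zero a
  | SuccIndex b of is_succ b a
  | LimitIndex of is_limit a.

Lemma indexP a : index_kind a.
Proof.
have [z|nz] := pselect (is_zero a); first exact: ZeroIndex.
have [[b sb]|ns] := pselect (exists b, is_succ b a); first exact: SuccIndex sb.
by apply: LimitIndex.
Qed.

End IndexOrder.

Section Games.
Variables (R : realType) (G : game R).
Implicit Types (i : player G) (l : elimination_type) (S : set (profile G)).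
Implicit Types F H : forall i : player G, set (@strategy R G i).

Definition update (x : profile G) i (c : strategy i) : profile G :=
  join_profile c (fun j => x (sval j)).

Lemma update_same (x : profile G) i (c : strategy i) : update x c i = c.
Proof.
rewrite /update /join_profile; case: pselect => // e.
by rewrite (Prop_irrelevance e erefl).
Qed.

Lemma update_other (x : profile G) i (c : strategy i) j :
  j <> i -> update x c j = x j.
Proof. by rewrite /update /join_profile; case: pselect. Qed.

Lemma box_update F (x : profile G) i (c : strategy i) :
  box F x -> F i c -> box F (update x c).
Proof.
move=> Fx Fc j; have [e|ne] := pselect (j = i).
  by subst j; rewrite update_same.
by rewrite update_other.
Qed.

(** In a profile of [box F], coordinate [i] can be replaced by any member of [F i]; non-emptiness
    provides such a profile. *)
Lemma box_subset_factors F H :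
  box F !=set0 -> box F `<=` box H -> forall i, F i `<=` H i.
Proof.
move=> [x Fx] FH i c Fc.
by rewrite -(update_same x c); apply: FH; apply: box_update.
Qed.

Lemma dominated_subset i (X Y : set (opponent_profile i)) (a b : strategy i) :
  Y !=set0 -> Y `<=` X -> dominated X a b -> dominated Y a b.
Proof. by move=> Y0 YX [_ ab]; split=> // x /YX; apply: ab. Qed.

Section Descent.
Variables (l : elimination_type) (s : ordinal_sequence (set (profile G))).
Hypothesis zero_term : forall a : Defs.index s, is_zero a -> term a = setT.
Hypothesis succ_term :
  forall a b : Defs.index s, is_succ a b -> reduces l (term a) (term b).
Hypothesis limit_term : forall a : Defs.index s, is_limit a ->
  term a = \bigcap_(b in [set b | index_lt b a]) term b.

Lemma term_decreasing (a b : Defs.index s) : index_le b a -> term a `<=` term b.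
Proof.
elim/index_ind: a b => a IH b ba.
have [->//|ne] := pselect (b = a).
case: (indexP a) => [z|c ca|lim].
- by case: ne; apply: index_le_anti => //; apply: z.
- apply: subset_trans (proj1 (succ_term ca)) _.
  apply: IH; first exact: ca.1.
  (* Otherwise [c] lies strictly below [b], so its successor [a] is at most [b], whence [b = a]. *)
  apply: contrapT => /not_index_le/ca.2 ab; apply: ne.
  exact: index_le_anti.
- by rewrite (limit_term lim) => x; apply.
Qed.

(** The least index whose term misses [x] is neither zero, where the term is everything, nor a
    limit, where the term is an intersection of earlier terms, all containing [x]. *)
Lemma eliminated_at_succ (a : Defs.index s) (x : profile G) :
  ~ term a x ->
  exists b c, [/\ is_succ b c, index_le c a, term b x & ~ term c x].
Proof.
move=> nax.
have [|c ncx cle] := @well_order_least _ _ [set c | ~ term c x]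
  (@index_well_order _ s); first by exists a.
have before b : index_lt b c -> term b x.
  move=> [bc ne]; apply: contrapT => nbx; apply: ne.
  by apply: index_le_anti => //; apply: cle.
case: (indexP c) => [z|b bc|lim].
- by case: ncx; rewrite zero_term.
- by exists b, c; split=> //; [exact: cle | apply: before; exact: bc.1].
- by case: ncx; rewrite limit_term.
Qed.

(** The fate of [c] is tracked on a single profile: [c] against opponents taken from a point of
    [box F]. If [c] were missing from [F i], this profile would be lost at some successor step. *)
Lemma undominated_survives (a : Defs.index s) F i (c : strategy i) :
  term a = box F -> box F !=set0 ->
  ~ (exists d, dominated (opponent_box F (i := i)) c d) -> F i c.
Proof.
move=> aF F0 und; have [x Fx] := F0; apply: contrapT => nFc.
have nay : ~ term a (update x c).
  by rewrite aF => /(_ i); rewrite update_same.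
have [b [b' [bb' b'a yb nyb']]] := eliminated_at_succ nay.
have [_ [K [H [bK b'H elim]]]] := succ_term bb'.
have FH : forall j, F j `<=` H j.
  by apply: box_subset_factors => //; rewrite -aF -b'H; apply: term_decreasing.
have FK : forall j, F j `<=` K j.
  apply: box_subset_factors => //; rewrite -aF -bK.
  exact: subset_trans (term_decreasing b'a) (proj1 (succ_term bb')).
have Kc : K i c.
  by rewrite bK in yb; have := yb i; rewrite update_same.
(* The other coordinates come from [x], which survives in [H], so only [c] can cause the loss of the
   profile. *)
have nHc : ~ H i c.
  move=> Hc; apply: nyb'; rewrite b'H; apply: box_update => // j.
  exact/FH/Fx.
have [d _ cd] := elim i c Kc nHc.
apply: und; exists d; apply: dominated_subset cd.
  by exists (fun j => x (sval j)) => j; apply: Fx.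
by move=> y Fy j; apply/FK/Fy.
Qed.

Hypothesis bounded : forall a : Defs.index s, completely_bounded (term a).

(** Being a term of the sequence matters: an undominated dominator could lie outside an arbitrary
    reduction. *)
Lemma reduces_term_indep (l1 l2 : elimination_type) (a : Defs.index s) S :
  reduces l1 (term a) S -> reduces l2 (term a) S.
Proof.
move=> [Sa [F [H [aF SH elim]]]]; split=> //.
have [F0|nF0] := pselect (box F !=set0); last first.
  (* An empty term forces [S] to be empty; with [F] representing both, no strategy is removed. *)
  exists F, F; split=> //; rewrite -aF eqEsubset; split=> // x.
  by rewrite aF => Fx; case: nF0; exists x.
exists F, H; split=> // i c Fc nHc; have [d _ cd] := elim i c Fc nHc.
(* For the universal type [d] itself serves; the nested type needs a dominator in [F i], hence an
   undominated one. *)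
case: l2; last by exists d.
have [|e ce und] := bounded aF Fc; first by exists d.
by exists e => //; apply: undominated_survives aF F0 und.
Qed.

End Descent.

Lemma elimination_sequences_subset (l1 l2 : elimination_type) :
  (forall S, reduction S -> completely_bounded S) ->
  elimination_sequences G l1 `<=` elimination_sequences G l2.
Proof.
move=> bounded s [red zero succ limit [Rhat [redRhat [a aRhat] stop]]].
have indep l l' (b : Defs.index s) S :
    reduces l (term b) S -> reduces l' (term b) S.
  by apply: (reduces_term_indep zero succ limit) => c; apply: bounded.
split=> //; first by move=> b c /succ; apply: indep.
exists Rhat; split=> //; first by exists a.
(* Here the transfer runs backwards, from [l2] to [l1]; it applies because [Rhat] is a term. *)
move=> S redS RS; apply: stop => //; rewrite -aRhat in RS *.
exact: indep RS.
Qed.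

End Games.

Theorem corollary1 (R : realType) (G : game R)
  (bounded : forall S : set (profile G), reduction S -> completely_bounded S) :
  elimination_sequences G nested = elimination_sequences G universal.
Proof.
by rewrite eqEsubset; split; apply: elimination_sequences_subset.
Qed.
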